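(* Let $F(\boldsymbol{\theta},K,a)=\boldsymbol{\Omega}+K\bigl(s(\boldsymbol{\theta})+a\,g_{pq}(\boldsymbol{\theta})\bigr)$ be the Kuramoto steady-state map described in the context, for a fixed pair of nodes $p<q$ and a fixed coupling constant $K$. Suppose that, when $a=0$, there exists a stable synchronous (phase-locked) steady state solution $\boldsymbol{\theta}^*\in\mathbb{R}^n$, i.e. $F(\boldsymbol{\theta}^*,K,0)=\mathbf{0}$. Denote the eigenvalues of the linearization $D_{\boldsymbol{\theta}}F(\boldsymbol{\theta}^*,K,0)$ by $\lambda_k$, with the assumption that $0=\lambda_1>\lambda_2\geq\lambda_3\geq\dots\geq\lambda_n$, with corresponding orthonormal eigenvectors $\mathbf{v}_1,\dots,\mathbf{v}_n$. Then for $a$ near $0$ there exists a steady state solution $\boldsymbol{\theta}^*(a)$ (that is, $F(\boldsymbol{\theta}^*(a),K,a)=\mathbf{0}$) with $\boldsymbol{\theta}^*(0)=\boldsymbol{\theta}^*$, and the order parameter $r(\boldsymbol{\theta}^*(a))$ is locally a smooth function of $a$ whose derivative satisfies \[\frac{d}{da}\left.\left(\frac{r(\boldsymbol{\theta}^*(a))^2}{2}\right)\right|_{a=0}=-\frac{K}{n^2}\sin\bigl(\theta^*_q(0)-\theta^*_p(0)\bigr)\sum_{k=2}^n\gamma_k\left(\frac{v_{k,p}-v_{k,q}}{\lambda_k}\right),\] where $v_{k,j}$ is the $j$-th entry of $\mathbf{v}_k$, \[\gamma_k=\mathbf{w}\cdot\mathbf{v}_k,\qquad w_j=S\cos\theta_j^*-C\sin\theta_j^*,\qquad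 C=\sum_{j=1}^n\cos\theta_j^*,\qquad S=\sum_{j=1}^n\sin\theta_j^*.\]
   Context: Let $A$ be the $n\times n$ adjacency matrix of a connected undirected graph on $\{1,\dots,n\}$ (so $A_{ij}=A_{ji}\in\{0,1\}$, $A_{ii}=0$). Let $\boldsymbol{\Omega}=(\omega_1,\dots,\omega_n)^T\in\mathbb{R}^n$ be the vector of natural frequencies, with the standing assumption $\sum_{i=1}^n\omega_i=0$. Fix nodes $p<q$. Define $s:\mathbb{R}^n\to\mathbb{R}^n$ by $s(\boldsymbol{\theta})_i=\sum_{j=1}^n A_{ij}\sin(\theta_j-\theta_i)$, and $g_{pq}(\boldsymbol{\theta})=\sin(\theta_q-\theta_p)(\mathbf{e}_p-\mathbf{e}_q)$, where $\mathbf{e}_k$ is the $k$-th standard basis vector of $\mathbb{R}^n$. Define $F:\mathbb{R}^n\times\mathbb{R}\times\mathbb{R}\to\mathbb{R}^n$ by $F(\boldsymbol{\theta},K,a)=\boldsymbol{\Omega}+K(s(\boldsymbol{\theta})+a\,g_{pq}(\boldsymbol{\theta}))$; $D_{\boldsymbol{\theta}}F$ is its $n\times n$ (symmetric) Jacobian matrix with respect to $\boldsymbol{\theta}$. Here $a$ is the weight of an edge added between $p$ and $q$; a steady state is a solution of $F(\boldsymbol{\theta},K,a)=\mathbf{0}$. The order parameter is $r(\boldsymbol{\theta})=\frac1n\left|\sum_{j=1}^n e^{\mathrm{i}\theta_j}\right|$, where $\mathrm{i}$ is the imaginary unit.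
   Formalization: Smoothness of r(θ*(a)) itself is asserted only when r(θ* ) ≠ 0, since for r(θ* ) = 0 it can behave like |a| (5-cycle, Ω = 0, θ*_j = 2πj/5, p = 1, q = 3); smoothness of r²/2 and the derivative formula are proved in all cases. *)

(* Defs.v *)
From HB Require Import structures.
From mathcomp Require Import all_boot all_order all_algebra.
From mathcomp Require Import all_classical all_reals all_analysis.
From mathcomp Require Import complex.

Set Implicit Arguments.
Unset Strict Implicit.
Unset Printing Implicit Defensive.

Import Order.TTheory GRing.Theory Num.Theory.
Import numFieldNormedType.Exports.

Local Open Scope ring_scope.
Local Open Scope classical_set_scope.

Record connected_adjacency (R : realType) (n : nat) (A : 'M[R]_n) : Prop := {
  adj_01 : forall i j, A i j = 0 \/ A i j = 1;
  adj_sym : forall i j, A i j = A j i;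
  adj_irr : forall i, A i i = 0;
  adj_conn : forall i j, connect (fun i j : 'I_n => A i j == 1) i j
}.

(* R^n is ['rV[R]_n]: since ['J f x] is the matrix with [u *m 'J f x = 'd f x u],
   the derivative acts on row vectors from the right. *)
Definition sine_coupling (R : realType) (n : nat) (A : 'M[R]_n)
    (theta : 'rV[R]_n) : 'rV[R]_n :=
  \row_i \sum_j A i j * sin (theta 0 j - theta 0 i).

Definition edge_coupling (R : realType) (n : nat) (p q : 'I_n)
    (theta : 'rV[R]_n) : 'rV[R]_n :=
  sin (theta 0 q - theta 0 p) *: (delta_mx 0 p - delta_mx 0 q).

Definition kuramoto (R : realType) (n : nat) (A : 'M[R]_n) (Omega : 'rV[R]_n)
    (p q : 'I_n) (theta : 'rV[R]_n) (K a : R) : 'rV[R]_n :=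
  Omega + K *: (sine_coupling A theta + a *: edge_coupling p q theta).

(* e^{i t} for real t, by Euler's formula. *)
Definition expi (R : realType) (t : R) : R[i] :=
  (cos t +i* sin t)%C.

Definition order_parameter (R : realType) (n : nat) (theta : 'rV[R]_n) : R :=
  ComplexField.Normc.normc (\sum_j expi (theta 0 j)) / n%:R.

Definition dotv (R : realType) (n : nat) (u v : 'rV[R]_n) : R :=
  \sum_j u 0 j * v 0 j.

(* The gradient of n^2 r^2 / 2 with respect to the phases. *)
Definition order_gradient (R : realType) (n : nat) (theta : 'rV[R]_n) :
    'rV[R]_n :=
  let C := \sum_j cos (theta 0 j) in
  let S := \sum_j sin (theta 0 j) in
  \row_j (S * cos (theta 0 j) - C * sin (theta 0 j)).

(* The library has no C^oo predicate: [f] is derivable at every order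
   throughout [U], which is meant to be open. *)
Definition smooth_on (R : realType) (U : set R) (f : R -> R) : Prop :=
  forall (m : nat) (x : R), U x -> derivable (f^`(m)) x 1.

(* Main.v *)
(* Writing sin u - sin v = (u - v) * sinc ((u - v) / 2) * cos ((u + v) / 2)
   turns differences of the Kuramoto map into exact products
   F x a - F y a = (x - y) *m L x y a with a continuous matrix L, and L x x a is
   the Jacobian.  Uniform phase shifts make the Jacobian singular, so one solves
   G x a = F x a + ((x - thetas) . v_1) v_1 = 0 instead: its Jacobian at thetas
   has eigenvalues 1, lambda_2, ..., lambda_n.  Since the entries of F sum to 0
   and v_1 is constant, G = 0 forces F = 0.  The branch theta a is the fixed
   point of a contraction; the factorization gives continuity and then the
   derivative - K g *m L^-1.  By Cramer's rule this derivative is a polynomial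
   in a, cos theta_i, sin theta_i and 1 / \det L, a class of functions which is
   therefore stable under derivation, whence smoothness of every order.
   Expanding L^-1 in the eigenbasis gives the formula; the v_1 term drops out
   because v_1 is constant. *)

Require Import Defs.
From HB Require Import structures.
From mathcomp Require Import all_boot all_order all_algebra.
From mathcomp Require Import all_classical all_reals all_analysis.
From mathcomp Require Import complex ring lra.

Set Implicit Arguments.
Unset Strict Implicit.
Unset Printing Implicit Defensive.

Import Order.TTheory GRing.Theory Num.Theory.
Import numFieldNormedType.Exports.

Local Open Scope ring_scope.
Local Open Scope classical_set_scope.

(* Completeness and the norm are both in the library, but not their join,
   which [banach_fixed_point] asks for. *)
HB.instance Definition _ (R : realType) (m n : nat) := Complete.on 'M[R]_(m, n).

(** * Limits of matrix-valued functions *)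

Lemma cvg_mx (R : realType) (T : Type) (F : set_system T) (FF : Filter F)
    (m n : nat) (f : T -> 'M[R]_(m, n)) (M : 'M[R]_(m, n)) :
  (forall i j, f x i j @[x --> F] --> M i j) -> f x @[x --> F] --> M.
Proof.
move=> fM A [P MP PA].
suff: \forall x \near F, A (f x) by [].
have : \forall x \near F, forall ij : 'I_m * 'I_n, P ij.1 ij.2 (f x ij.1 ij.2).
  by apply: filter_forall => -[i j] /=; exact: fM (MP i j).
by apply: filterS => x Px; apply: PA => i j; exact: (Px (i, j)).
Qed.

Lemma cvg_mx_coord (R : realType) (T : Type) (F : set_system T)
    (FF : Filter F) (m n : nat) (f : T -> 'M[R]_(m, n)) (M : 'M[R]_(m, n)) i j :
  f x @[x --> F] --> M -> f x i j @[x --> F] --> M i j.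
Proof.
move=> fM.
exact: (@cvg_comp _ _ _ f (fun N => N i j) F _ _ fM
  (@coord_continuous _ _ _ i j M)).
Qed.

Lemma cvg_bigsum (R : realType) (T : Type) (F : set_system T) (FF : Filter F)
    (I : Type) (r : seq I) (P : pred I) (f : I -> T -> R) (l : I -> R) :
  (forall i, P i -> f i x @[x --> F] --> l i) ->
  \sum_(i <- r | P i) f i x @[x --> F] --> \sum_(i <- r | P i) l i.
Proof. by apply: cvg_big; exact: add_continuous. Qed.

Lemma cvg_bigprod (R : realType) (T : Type) (F : set_system T) (FF : Filter F)
    (I : Type) (r : seq I) (P : pred I) (f : I -> T -> R) (l : I -> R) :
  (forall i, P i -> f i x @[x --> F] --> l i) ->
  \prod_(i <- r | P i) f i x @[x --> F] --> \prod_(i <- r | P i) l i.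
Proof. by apply: cvg_big; exact: mul_continuous. Qed.

Lemma cvg_mulmx (R : realType) (T : Type) (F : set_system T) (FF : Filter F)
    (m n p : nat) (f : T -> 'M[R]_(m, n)) (g : T -> 'M[R]_(n, p))
    (M : 'M[R]_(m, n)) (N : 'M[R]_(n, p)) :
  f x @[x --> F] --> M -> g x @[x --> F] --> N ->
  f x *m g x @[x --> F] --> M *m N.
Proof.
move=> fM gN; apply: cvg_mx => i j; rewrite mxE.
under eq_cvg do rewrite mxE.
by apply: cvg_bigsum => k _; apply: cvgM; exact: cvg_mx_coord.
Qed.

Lemma cvg_det (R : realType) (T : Type) (F : set_system T) (FF : Filter F)
    (n : nat) (f : T -> 'M[R]_n) (M : 'M[R]_n) :
  f x @[x --> F] --> M -> \det (f x) @[x --> F] --> \det M.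
Proof.
move=> fM; apply: cvg_bigsum => s _; apply: cvgM; first exact: cvg_cst.
by apply: cvg_bigprod => i _; exact: cvg_mx_coord.
Qed.

Lemma cvg_invmx (R : realType) (T : Type) (F : set_system T) (FF : Filter F)
    (n : nat) (f : T -> 'M[R]_n) (M : 'M[R]_n) : M \in unitmx ->
  f x @[x --> F] --> M -> invmx (f x) @[x --> F] --> invmx M.
Proof.
move=> uM fM.
have dM0 : \det M != 0 by rewrite -unitfE -unitmxE.
have df := cvg_det FF fM.
have fu : \forall x \near F, f x \in unitmx.
  by near=> x; rewrite unitmxE unitfE; near: x; exact: (cvgr_neq0 (\det M)).
have adjf : \adj (f x) @[x --> F] --> \adj M.
  apply: cvg_mx => i j; rewrite mxE; under eq_cvg do rewrite mxE.
  apply: cvgM; first exact: cvg_cst.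
  apply: cvg_det; apply: cvg_mx => k l; rewrite !mxE.
  by under eq_cvg do rewrite !mxE; exact: cvg_mx_coord.
(* [invmx] is Cramer's formula only on units; this suffices because [f x] is eventually a unit. *)
rewrite /invmx uM.
apply: cvg_trans (_ : ((\det (f x))^-1 *: \adj (f x)) @[x --> F] --> _);
  last first.
  by apply: cvgZ => //; exact: cvgV.
apply: near_eq_cvg; near=> x.
have -> // : f x \in unitmx by near: x.
Unshelve. all: by end_near. Qed.

(** * An implicit function theorem for maps with factored differences *)

Lemma norm_mulmx_le (R : realType) (m n p : nat) (A : 'M[R]_(m, n))
    (B : 'M[R]_(n, p)) : `|A *m B| <= n%:R * `|B| * `|A|.
Proof.
have coordE k l (C : 'M[R]_(k, l)) i j : `|C i j| <= `|C|.
  rewrite [leRHS](mx_normrE C).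
  by apply/bigmax_geP; right => /=; exists (i, j).
rewrite [leLHS](mx_normrE (A *m B)); apply/bigmax_leP; split => [|[i j] _ /=].
  by rewrite !mulr_ge0.
rewrite mxE (le_trans (ler_norm_sum _ _ _))//.
rewrite (@le_trans _ _ (\sum_(k < n) `|B| * `|A|))//.
  by apply: ler_sum => k _; rewrite normrM mulrC ler_pM.
by rewrite sumr_const card_ord -[leLHS]mulr_natl mulrA.
Qed.

(** Zeros of [G] at parameter [a] are fixed points of the chord Newton map [x - G x a *m N]. Its
    differences are [(x - y) *m D x y a], and [D] vanishes at the base point, so the map halves
    distances on a small ball. *)
Lemma implicit_function (R : realType) (n : nat) (G : 'rV[R]_n -> R -> 'rV[R]_n)
    (L : 'rV[R]_n -> 'rV[R]_n -> R -> 'M[R]_n) (x0 : 'rV[R]_n) :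
  (forall x y a, G x a - G y a = (x - y) *m L x y a) ->
  continuous (fun z : 'rV[R]_n * 'rV[R]_n * R => L z.1.1 z.1.2 z.2) ->
  (forall x, continuous (G x)) ->
  G x0 0 = 0 -> L x0 x0 0 \in unitmx ->
  exists (theta : R -> 'rV[R]_n) (e : R),
    [/\ 0 < e, theta 0 = x0 &
        forall a, `|a| < e ->
          [/\ G (theta a) a = 0, {for a, continuous theta} &
              L (theta a) (theta a) a \in unitmx]].
Proof.
move=> GL Lc Gc G0 uM.
set N := invmx (L x0 x0 0).
pose D x y a := 1%:M - L x y a *m N.
have [r r0 Dr] : exists2 r : R, 0 < r & forall x y a,
    `|x0 - x| <= r -> `|x0 - y| <= r -> `|a| <= r -> forall u : 'rV[R]_n,
    `|u *m D x y a| <= 2^-1 * `|u|.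
  have Dc : (1%:M - L z.1.1 z.1.2 z.2 *m N)
      @[z --> ((x0, x0, 0) : 'rV[R]_n * 'rV[R]_n * R)] --> (0 : 'M[R]_n).
    rewrite -(subrr (1%:M : 'M[R]_n)) -(mulmxV uM).
    apply: cvgB; first by rewrite mulmxV//; exact: cvg_cst.
    by apply: cvg_mulmx; [exact: (Lc (x0, x0, 0))|exact: cvg_cst].
  (* Multiplication costs a factor [n] in the max norm, hence this bound for a final ratio 1/2;
     [n.+1] keeps it positive even for [n = 0]. *)
  have c0 : 0 < (2 * n.+1%:R)^-1 :> R by rewrite invr_gt0 mulr_gt0.
  move/cvgrPdist_le : Dc => /(_ _ c0) /nbhs_ballP[r /= r0 rD].
  (* Half the radius, so that the non-strict bounds still land in the open ball. *)
  exists (r / 2); first by rewrite divr_gt0.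
  move=> x y a xr yr ar u.
  have hr : r / 2 < r by rewrite ltr_pdivrMr// ltr_pMr// ltr1n.
  have /rD : ball ((x0, x0, 0) : 'rV[R]_n * 'rV[R]_n * R) r (x, y, a).
    split; first split; rewrite /= -ball_normE /=.
    - exact: le_lt_trans hr.
    - exact: le_lt_trans hr.
    - by rewrite sub0r normrN; exact: le_lt_trans hr.
  rewrite sub0r normrN => Dle.
  rewrite (le_trans (norm_mulmx_le _ _))// ler_wpM2r//.
  rewrite (@le_trans _ _ (n.+1%:R * (2 * n.+1%:R)^-1))//.
    by rewrite ler_pM// ler_nat.
  by rewrite invfM mulrCA divff ?mulr1.
have NE x y a : x - G x a *m N - (y - G y a *m N) = (x - y) *m D x y a.
  rewrite /D mulmxBr mulmx1 mulmxA -GL mulmxBl !opprB.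
  by rewrite addrACA [RHS]addrACA (addrC (- y)).
have GN0 x a : G x a *m N = 0 -> G x a = 0.
  by move=> /(congr1 (mulmx^~ (L x0 x0 0))); rewrite mulmxKV// mul0mx.
have GNc x : continuous (fun a => G x a *m N).
  by move=> a; apply: cvg_mulmx; [exact: Gc|exact: cvg_cst].
have half (s t : R) : s <= 2^-1 * s + t -> s <= 2 * t.
  by move=> st; lra.
(* A residual of at most [r / 2] at the centre, plus half of a distance at most [r], keeps the
   closed ball stable under the Newton map. *)
have [e [e0 er eG]] : exists e, [/\ 0 < e, e <= r &
    forall a, `|a| < e -> `|G x0 a *m N| <= r / 2].
  have := GNc x0 0; rewrite /continuous_at G0 mul0mx => /cvgrPdist_le.
  have r20 : 0 < r / 2 by rewrite divr_gt0.
  move=> /(_ _ r20) /nbhs_ballP[e /= e0 eG]; exists (Num.min e r).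
  rewrite lt_min e0 r0 ge_min lexx orbT; split=> // a.
  rewrite lt_min => /andP[ae _].
  have := eG a; rewrite sub0r normrN; apply.
  by rewrite -ball_normE /= sub0r normrN.
have ex a : exists x, `|a| < e -> `|x0 - x| <= r /\ G x a = 0.
  (* For parameters out of range, [x0] is a dummy value that lets [choice] apply. *)
  have [ae|] := boolP (`|a| < e); last by exists x0.
  pose U := closed_ball_ Num.norm x0 r.
  have TU x : U x -> U (x - G x a *m N).
    rewrite /U /closed_ball_/= => Ux.
    have -> : x0 - (x - G x a *m N) =
        - ((x - x0) *m D x x0 a) + G x0 a *m N.
      by rewrite -NE !opprD !opprK; apply/rowP => i; rewrite !mxE; ring.
    rewrite (le_trans (ler_normD _ _))// normrN.
    have := Dr x x0 a Ux; rewrite subrr normr0 => /(_ (ltW r0) _ (x - x0)).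
    rewrite (le_trans (ltW ae))// (distrC x) => /(_ isT).
    have := eG _ ae; move: Ux; lra.
  pose T : {fun U >-> U} := mkfun TU.
  have [|||x Ux Tx] := @banach_fixed_point _ _ U T.
  - exists (2^-1)%:nng; split; first by rewrite /= invf_lt1 ?ltr1n.
    move=> [x y] [/= Ux Uy]; rewrite NE.
    by apply: Dr => //; rewrite (le_trans (ltW ae)).
  - exact: closed_closed_ball_.
  - by exists x0; rewrite /U /closed_ball_ /= subrr normr0 ltW.
  exists x => _; split => //; apply: GN0.
  have : x + 0 = x - G x a *m N by rewrite addr0; exact: Tx.
  by move=> /addrI/esym/eqP; rewrite oppr_eq0 => /eqP.
have /choice[theta thetaP] := ex.
(* [choice] does not prescribe the value at 0, but [theta 0] and [x0] are both zeros in the ball,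
   and a map halving distances has at most one fixed point. *)
have theta0 : theta 0 = x0.
  have [|x0r Gx] := thetaP 0; first by rewrite normr0.
  have := NE (theta 0) x0 0; rewrite Gx G0 !mul0mx !subr0 => E0.
  have := Dr (theta 0) x0 0 x0r.
  rewrite subrr !normr0 => /(_ (ltW r0) (ltW r0)).
  move=> /(_ (theta 0 - x0)); rewrite -E0 => h.
  apply/eqP; rewrite -subr_eq0 -normr_le0; move: h; lra.
exists theta, e; split => // a ae; have [xr Gx] := thetaP a ae; split => //.
(* The distance between two branch points is at most twice the residual of [theta a] at parameter
   [b], which tends to 0 as [b] tends to [a]. *)
- have lip b : `|b| < e -> `|theta a - theta b| <= 2 * `|G (theta a) b *m N|.
    move=> be; have [yr Gy] := thetaP b be; apply: half.
    have := NE (theta a) (theta b) b; rewrite Gy mul0mx subr0 => E0.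
    have {}E0 : theta a - theta b =
        (theta a - theta b) *m D (theta a) (theta b) b + G (theta a) b *m N.
      by rewrite -E0 addrAC subrK.
    rewrite [in leLHS]E0 (le_trans (ler_normD _ _))// lerD2r.
    by apply: Dr => //; rewrite (le_trans (ltW be)).
  apply/cvgrPdist_le => /= d d0.
  have d20 : 0 < d / 2 by rewrite divr_gt0.
  have := GNc (theta a) a; rewrite /continuous_at Gx mul0mx => /cvgrPdist_le.
  move=> /(_ _ d20) Gd.
  near=> b; have be : `|b| < e.
    by near: b; apply: (@cvgr_norm_lt _ _ _ _ _ id a) => //.
  rewrite (le_trans (lip _ be))// mulrC -ler_pdivlMr// -normrN -sub0r.
  by near: b.
(* A row killed by [L] is fixed by [D], which halves norms, so it is zero. *)
- rewrite -row_free_unit -kermx_eq0; apply/rowV0P => u /sub_kermxP uL.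
  have := Dr _ _ a xr xr (le_trans (ltW ae) er) u.
  rewrite /D mulmxBr mulmxA uL mul0mx mulmx1 subr0 => h.
  by apply/eqP; rewrite -normr_le0; move: h; lra.
Unshelve. all: by end_near. Qed.

(** * Derivatives obtained from exact factorizations *)

Lemma is_derive_mx_coord (R : realType) (V : normedModType R) (m n : nat)
    (M : V -> 'M[R]_(m, n)) (x v : V) (D : 'M[R]_(m, n)) i j :
  is_derive x v M D -> is_derive x v (fun y => M y i j) (D i j).
Proof.
move=> [dM <-]; apply: DeriveDef; first exact: (derivable_mxP M x v).1.
by rewrite derive_mx// mxE.
Qed.

(** Changing the point and the parameter in turn gives [(theta b - theta a) *m L (theta b) (theta a)
    b = (a - b) *: h (theta a)]. Hence the difference quotient is exactly [Q b], and [Q] is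
    continuous at [a]. *)
Lemma implicit_function_derive (R : realType) (n : nat)
    (G : 'rV[R]_n -> R -> 'rV[R]_n) (L : 'rV[R]_n -> 'rV[R]_n -> R -> 'M[R]_n)
    (h : 'rV[R]_n -> 'rV[R]_n) (theta : R -> 'rV[R]_n) (a : R) :
  (forall x y b, G x b - G y b = (x - y) *m L x y b) ->
  continuous (fun z : 'rV[R]_n * 'rV[R]_n * R => L z.1.1 z.1.2 z.2) ->
  (forall x b c, G x b - G x c = (b - c) *: h x) ->
  (\forall b \near a, G (theta b) b = 0) ->
  {for a, continuous theta} -> L (theta a) (theta a) a \in unitmx ->
  is_derive a 1 theta (- (h (theta a) *m invmx (L (theta a) (theta a) a))).
Proof.
move=> GL Lc Gh Gnear tc uL.
have Lac : L (theta b) (theta a) b @[b --> a] --> L (theta a) (theta a) a.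
  pose L3 (z : 'rV[R]_n * 'rV[R]_n * R) := L z.1.1 z.1.2 z.2.
  apply: (@cvg_comp _ _ _ (fun b => (theta b, theta a, b)) L3 _
    (nbhs (theta a, theta a, a)) _ _ (Lc (theta a, theta a, a))).
  apply: (@cvg_pair _ _ _ (nbhs a) (nbhs (theta a, theta a)) (nbhs a)).
    apply: (@cvg_pair _ _ _ (nbhs a) (nbhs (theta a)) (nbhs (theta a))).
      exact: tc.
    exact: cvg_cst.
  exact: cvg_id.
pose Q b := - (h (theta a) *m invmx (L (theta b) (theta a) b)).
have Qa : Q b @[b --> a] --> Q a.
  apply: cvgN; apply: cvg_mulmx; first exact: cvg_cst.
  exact: cvg_invmx.
have step : \forall b \near a, theta b - theta a = (b - a) *: Q b.
  near=> b.
  have ub : L (theta b) (theta a) b \in unitmx.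
    rewrite unitmxE unitfE; near: b.
    apply: (cvgr_neq0 (\det (L (theta a) (theta a) a))).
      exact: cvg_det.
    by rewrite -unitfE -unitmxE.
  have Gb : G (theta b) b = 0 by near: b.
  have Ga : G (theta a) a = 0 by exact: nbhs_singleton Gnear.
  have := GL (theta b) (theta a) b; rewrite Gb -Ga => E.
  have := Gh (theta a) a b; rewrite E.
  move=> /(congr1 (mulmx^~ (invmx (L (theta b) (theta a) b)))).
  by rewrite mulmxK// -scalemxAl => ->; rewrite -opprB scaleNr scalerN.
have lim : h^-1 *: (theta (h *: 1 + a) - theta a) @[h --> (0 : R)^'] --> Q a.
  have sh : k *: 1 + a @[k --> (0 : R)^'] --> a.
    under eq_cvg do rewrite /= [_ *: _]mulr1.
    exact: (continuous_withinNshiftx id a).2.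
  apply: cvg_trans (cvg_comp _ _ sh Qa); apply: near_eq_cvg; near=> k.
  have k0 : k != 0 by near: k; exact: nbhs_dnbhs_neq.
  have /= -> : theta (k *: 1 + a) - theta a =
      (k *: 1 + a - a) *: Q (k *: 1 + a).
    by near: k; exact: sh _ step.
  by rewrite addrK [_ *: 1]mulr1 scalerA mulVf// scale1r.
apply: DeriveDef; first by apply/cvg_ex; exists (Q a).
exact: cvg_lim lim.
Unshelve. all: by end_near. Qed.

(** The linearization error for an increment [h] is exactly [h *m (L (h + x0) - L x0)], a small o of
    [h]. *)
Lemma jacobian_divided_difference (R : realType) (m n : nat)
    (f : 'rV[R]_m -> 'rV[R]_n) (x0 : 'rV[R]_m) (L : 'rV[R]_m -> 'M[R]_(m, n)) :
  (forall x, f x - f x0 = (x - x0) *m L x) -> {for x0, continuous L} ->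
  'J f x0 = L x0.
Proof.
move=> fL Lc.
have dfE : 'd f x0 = mulmxr (L x0) :> (_ -> _).
  apply: diff_unique.
    move=> x; apply: (@cvg_mulmx _ _ (nbhs x) _ _ _ _ id (cst (L x0))).
      exact: cvg_id.
    exact: cvg_cst.
  apply/eqaddoP => _/posnumP[eps].
  have c0 : 0 < eps%:num / m.+1%:R by rewrite divr_gt0.
  have : (L \o shift x0) h @[h --> (0 : 'rV[R]_m)] --> L x0.
    by rewrite cvg_comp_shift add0r.
  move=> /cvgrPdist_le/(_ _ c0) /= Ls.
  near=> h.
  rewrite [X in `|X|](_ : _ = h *m (L (h + x0) - L x0)).
    rewrite (le_trans (norm_mulmx_le _ _))// ler_wpM2r// distrC.
    have : `|L x0 - L (h + x0)| <= eps%:num / m.+1%:R by near: h.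
    rewrite ler_pdivlMr// mulrC; apply: le_trans.
    by rewrite ler_wpM2r// ler_nat.
  by rewrite /= !fctE mulmxBr opprD addrA fL addrK.
apply/matrixP => i j; rewrite mxE dfE /=.
by rewrite -rowE mxE.
Unshelve. all: by end_near. Qed.

(** * Function algebras stable under derivation *)

(** Polynomials with real coefficients in the functions of [gen], given inductively so that they can
    be differentiated by induction. *)
Inductive generated (R : realType) (gen : set (R -> R)) : (R -> R) -> Prop :=
| generated_gen f : gen f -> generated gen f
| generated_cst c : generated gen (cst c)
| generated_add f g :
    generated gen f -> generated gen g -> generated gen (f \+ g)
| generated_mul f g :
    generated gen f -> generated gen g -> generated gen (f \* g).

Lemma generatedS (R : realType) (gen gen' : set (R -> R)) :
  gen `<=` gen' -> generated gen `<=` generated gen'.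
Proof.
move=> gg' f; elim=> {f}[f gf|c|f g _ gf _ gg|f g _ gf _ gg].
- exact/generated_gen/gg'.
- exact: generated_cst.
- exact: generated_add.
- exact: generated_mul.
Qed.

Lemma generated_opp (R : realType) (gen : set (R -> R)) (f : R -> R) :
  generated gen f -> generated gen (fun x => - f x).
Proof.
move=> gf; under eq_fun do rewrite -mulN1r.
exact: generated_mul (generated_cst _ (-1)) gf.
Qed.

(** The sum and product rules. Two generating sets are kept apart because derivatives may call for a
    new generator, such as the inverse of a determinant. *)
Lemma generated_derive (R : realType) (gen gen' : set (R -> R)) (U : set R) :
  gen `<=` gen' ->
  (forall f, gen f ->
     exists2 g, generated gen' g & forall x, U x -> is_derive x 1 f (g x)) ->
  forall f, generated gen f ->
    exists2 g, generated gen' g & forall x, U x -> is_derive x 1 f (g x).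
Proof.
move=> gg' dgen f; elim=> {f}[//|c|f g gf [df gdf fdf] gg [dg gdg gdg']
  |f g gf [df gdf fdf] gg [dg gdg gdg']].
- by exists (cst 0) => [|x _]; [exact: generated_cst|exact: is_derive_cst].
- exists (df \+ dg); first exact: generated_add.
  by move=> x Ux; apply: is_deriveD; [exact: fdf|exact: gdg'].
- exists ((f \* dg) \+ (g \* df)).
    by apply: generated_add; apply: generated_mul => //;
      exact: (generatedS gg').
  by move=> x Ux; apply: is_deriveM; [exact: fdf|exact: gdg'].
Qed.

(** Each iterated derivative agrees on [U] with a member of the algebra; since [U] is open the
    agreement is local and can be differentiated again. *)
Lemma generated_smooth (R : realType) (gen : set (R -> R)) (U : set R) :
  open U ->
  (forall f, gen f ->
     exists2 g, generated gen g & forall x, U x -> is_derive x 1 f (g x)) ->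
  forall f, generated gen f -> smooth_on U f.
Proof.
move=> oU dgen f gf m.
have near_eq (g h : R -> R) x : U x -> (forall y, U y -> g y = h y) ->
    \forall y \near x, g y = h y.
  by move=> Ux gh; apply: filterS gh _; exact: open_nbhs_nbhs.
have [g gg fg] : exists2 g, generated gen g & forall x, U x -> f^`(m) x = g x.
  elim: m => [|m [g gg fg]]; first by exists f => // x _; rewrite derive1n0.
  have [g' gg' dg] := generated_derive (@subset_refl _ gen) dgen gg.
  exists g' => // x Ux; rewrite derive1nS derive1E.
  have [_ dgx] := dg x Ux; rewrite -dgx.
  by apply: near_eq_derive; exact: near_eq Ux fg.
move=> x Ux.
have [g' _ dg] := generated_derive (@subset_refl _ gen) dgen gg.
apply: (@near_eq_derivable _ _ _ g); last by case: (dg x Ux).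
by apply: near_eq => // y Uy; rewrite fg.
Qed.

(** Adjoin the root [s] and its inverse [t]: [s' = t f' / 2] and [t' = - t^2 s'], so the enlarged
    algebra is again stable. *)
Lemma generated_smooth_sqrt (R : realType) (gen : set (R -> R)) (U : set R) :
  open U ->
  (forall f, gen f ->
     exists2 g, generated gen g & forall x, U x -> is_derive x 1 f (g x)) ->
  forall f, generated gen f -> (forall x, U x -> 0 < f x) ->
  smooth_on U (fun x => Num.sqrt (f x)).
Proof.
move=> oU dgen f gf f0.
pose s x := Num.sqrt (f x); pose t x := (s x)^-1.
pose gen' := gen `|` [set s; t].
have gg' : gen `<=` gen' by exact: subsetUl.
have gs : generated gen' s by apply: generated_gen; right; left.
have gt : generated gen' t by apply: generated_gen; right; right.
have [f' gf' df] := generated_derive (@subset_refl _ gen) dgen gf.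
have gs' : generated gen' (fun x => 2^-1 * (t x * f' x)).
  apply: (generated_mul (generated_cst _ _)).
  by apply: (generated_mul gt); exact: (generatedS gg').
have ds x : U x -> is_derive x 1 s (2^-1 * (t x * f' x)).
  move=> Ux; have := is_derive1_comp (is_derive1_sqrt (f0 x Ux)) (df x Ux).
  by rewrite invfM mulrA.
apply: (@generated_smooth _ gen') => // g [gg|[->|->]].
- by have [g' gg'' dg] := dgen g gg; exists g' => //; exact: (generatedS gg').
- by exists (fun x => 2^-1 * (t x * f' x)).
- exists (fun x => - (t x * t x * (2^-1 * (t x * f' x)))).
    by apply: generated_opp; apply: generated_mul => //; exact: generated_mul.
  move=> x Ux; have s0 : s x != 0 by rewrite sqrtr_eq0 -ltNge f0.
  have := is_deriveV s0 (ds x Ux).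
  by rewrite /t expr2 invfM -[_ *: _]/(_ * _) mulNr.
Qed.

Lemma generated_sum (R : realType) (gen : set (R -> R)) (I : Type) (r : seq I)
    (P : pred I) (f : I -> R -> R) :
  (forall i, P i -> generated gen (f i)) ->
  generated gen (fun x => \sum_(i <- r | P i) f i x).
Proof.
move=> gf; elim: r => [|i r IH].
  by under eq_fun do rewrite big_nil; exact: generated_cst.
case Pi: (P i); under eq_fun do rewrite big_cons Pi; last exact: IH.
exact: generated_add (gf i Pi) IH.
Qed.

Lemma generated_prod (R : realType) (gen : set (R -> R)) (I : Type) (r : seq I)
    (P : pred I) (f : I -> R -> R) :
  (forall i, P i -> generated gen (f i)) ->
  generated gen (fun x => \prod_(i <- r | P i) f i x).
Proof.
move=> gf; elim: r => [|i r IH].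
  by under eq_fun do rewrite big_nil; exact: generated_cst.
case Pi: (P i); under eq_fun do rewrite big_cons Pi; last exact: IH.
exact: generated_mul (gf i Pi) IH.
Qed.

Lemma generated_det (R : realType) (gen : set (R -> R)) (n : nat)
    (M : R -> 'M[R]_n) :
  (forall i j, generated gen (fun x => M x i j)) ->
  generated gen (fun x => \det (M x)).
Proof.
move=> gM; apply: generated_sum => s _.
apply: (generated_mul (generated_cst gen _)).
by apply: generated_prod => i _; exact: gM.
Qed.

Lemma generated_adj (R : realType) (gen : set (R -> R)) (n : nat)
    (M : R -> 'M[R]_n) :
  (forall i j, generated gen (fun x => M x i j)) ->
  forall i j, generated gen (fun x => (\adj (M x)) i j).
Proof.
move=> gM i j; under eq_fun do rewrite mxE.
apply: (generated_mul (generated_cst gen _)); apply: generated_det => k l.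
by under eq_fun do rewrite !mxE; exact: gM.
Qed.

(** * Divided differences of the sine and of the Kuramoto map *)

Definition sinc (R : realType) (t : R) : R := if t == 0 then 1 else sin t / t.

(** At 0 the limit is the derivative of the sine, [cos 0 = 1]. *)
Lemma sinc_continuous (R : realType) : continuous (@sinc R).
Proof.
move=> t; have [->|t0] := eqVneq t 0.
  apply/continuous_withinNx; rewrite /sinc eqxx.
  have [dl dE] := @is_derive_sin R 0.
  have ds : h^-1 *: ((sin \o shift 0) (h *: 1) - sin 0) @[h --> 0^'] -->
      (1 : R).
    by rewrite -[X in _ --> X](@cos0 R) -dE; exact: dl.
  apply: cvg_trans ds; apply: near_eq_cvg; near=> h.
  have h0 : h != 0 by near: h; exact: nbhs_dnbhs_neq.
  by rewrite /= (negbTE h0) sin0 subr0 addr0 [h *: 1]mulr1 mulrC.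
have st : (sin u / u) @[u --> t] --> sin t / t.
  by apply: cvgM; [exact: continuous_sin|apply: cvgV => //; exact: cvg_id].
rewrite /continuous_at [X in _ --> X](_ : _ = sin t / t); last first.
  by rewrite /sinc (negbTE t0).
apply: cvg_trans st; apply: near_eq_cvg; near=> u.
have u0 : u != 0 by near: u; apply: (cvgr_neq0 t) => //; exact: cvg_id.
by rewrite /sinc (negbTE u0).
Unshelve. all: by end_near. Qed.

Definition sin_slope (R : realType) (u v : R) : R :=
  sinc ((u - v) / 2) * cos ((u + v) / 2).

(** With half-sum [s] and half-difference [d], this is [sin (s + d) - sin (s - d) = 2 cos s sin
    d]. *)
Lemma sin_slopeE (R : realType) (u v : R) :
  sin u - sin v = (u - v) * sin_slope u v.
Proof.
set s := (u + v) / 2; set d := (u - v) / 2.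
have -> : u = s + d by rewrite /s /d; lra.
have -> : v = s - d by rewrite /s /d; lra.
rewrite sinD sinB /sin_slope.
have -> : (s + d - (s - d)) / 2 = d by lra.
have -> : (s + d + (s - d)) / 2 = s by lra.
rewrite /sinc; have [->|d0] := eqVneq d 0; first by rewrite sin0; ring.
by field.
Qed.

Lemma sin_slope_diag (R : realType) (u : R) : sin_slope u u = cos u.
Proof.
rewrite /sin_slope /sinc subrr mul0r eqxx mul1r.
by congr cos; lra.
Qed.

Lemma cvg_sin_slope (R : realType) (T : Type) (F : set_system T)
    (FF : Filter F) (f g : T -> R) (u v : R) :
  f x @[x --> F] --> u -> g x @[x --> F] --> v ->
  sin_slope (f x) (g x) @[x --> F] --> sin_slope u v.
Proof.
move=> fu gv; apply: cvgM.
  apply: continuous_cvg; first exact: sinc_continuous.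
  by apply: cvgMl; exact: cvgB.
apply: continuous_cvg; first exact: continuous_cos.
by apply: cvgMl; exact: cvgD.
Qed.

(* For a phase displacement [u], [u *m laplacian W] has entries
   [\sum_j W i j * (u j - u i)]: this is minus the usual graph Laplacian. *)
Definition laplacian (R : realType) (n : nat) (W : 'M[R]_n) : 'M[R]_n :=
  W^T - diag_mx (\row_i \sum_j W i j).

Lemma mul_laplacian (R : realType) (n : nat) (W : 'M[R]_n) (u : 'rV[R]_n) i :
  (u *m laplacian W) 0 i = \sum_j W i j * (u 0 j - u 0 i).
Proof.
rewrite /laplacian mulmxBr mxE mul_mx_diag !mxE mulr_sumr -sumrB.
by apply: eq_bigr => j _; rewrite !mxE; ring.
Qed.

(** Symmetry makes the row sums on the diagonal cancel the column sums of [W]. Consequently every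
    [u *m laplacian W] has entries summing to 0. *)
Lemma laplacian_const (R : realType) (n : nat) (W : 'M[R]_n) :
  W^T = W -> laplacian W *m (const_mx 1 : 'cV_n) = 0.
Proof.
move=> WT; rewrite /laplacian WT mulmxBl mul_diag_mx.
apply/matrixP => i j; rewrite !mxE mulr1 -sumrB.
by apply: big1 => k _; rewrite mxE mulr1 subrr.
Qed.

(** Edge weights multiplied by secant slopes of the sine; for [x = y] they are
    [B i j * cos (x 0 j - x 0 i)], the weights of the Jacobian. *)
Definition slope_weights (R : realType) (n : nat) (B : 'M[R]_n)
    (x y : 'rV[R]_n) : 'M[R]_n :=
  \matrix_(i, j) (B i j * sin_slope (x 0 j - x 0 i) (y 0 j - y 0 i)).

Lemma sine_coupling_slope (R : realType) (n : nat) (B : 'M[R]_n)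
    (x y : 'rV[R]_n) :
  sine_coupling B x - sine_coupling B y =
  (x - y) *m laplacian (slope_weights B x y).
Proof.
apply/rowP => i; rewrite mul_laplacian !mxE -sumrB; apply: eq_bigr => j _.
by rewrite -mulrBr sin_slopeE !mxE; ring.
Qed.

(** Exchanging [i] and [j] changes the sign of every term, the sine being odd. *)
Lemma sum_sine_coupling (R : realType) (n : nat) (B : 'M[R]_n)
    (x : 'rV[R]_n) : B^T = B -> \sum_i sine_coupling B x 0 i = 0.
Proof.
move=> BT; set s := LHS.
have : s = - s.
  rewrite {1}/s; under eq_bigr do rewrite mxE.
  rewrite exchange_big /= -sumrN; apply: eq_bigr => i _.
  rewrite mxE -sumrN; apply: eq_bigr => j _.
  by rewrite -[B in LHS]BT mxE -[x 0 i - _]opprB sinN mulrN.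
lra.
Qed.

Definition add_edge (R : realType) (n : nat) (A : 'M[R]_n) (p q : 'I_n)
    (a : R) : 'M[R]_n :=
  A + a *: (delta_mx p q + delta_mx q p).

(** Absorbing the new edge into one symmetric weighted adjacency matrix lets the sine coupling
    lemmas cover every [a]. *)
Lemma kuramoto_add_edge (R : realType) (n : nat) (A : 'M[R]_n)
    (Omega : 'rV[R]_n) (p q : 'I_n) (theta : 'rV[R]_n) (K a : R) :
  kuramoto A Omega p q theta K a =
  Omega + K *: sine_coupling (add_edge A p q a) theta.
Proof.
congr (_ + _ *: _); apply/rowP => i; rewrite !mxE eqxx /=.
under [RHS]eq_bigr do rewrite !mxE mulrDl.
rewrite big_split; congr (_ + _).
pose s j := sin (theta 0 j - theta 0 i).
(* The new edge contributes only [j = q] in row [p] and [j = p] in row [q]. *)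
transitivity (\sum_j ((if j == q then a * (i == p)%:R * s j else 0) +
                      (if j == p then a * (i == q)%:R * s j else 0)));
  rewrite /s.
  rewrite big_split -!big_mkcond !big_pred1_eq /=.
  have [<-|ip] := eqVneq i p; have [<-|iq] := eqVneq i q;
    rewrite ?subrr ?sin0 /=; try ring.
  by rewrite -(opprB (theta 0 i)) sinN; ring.
apply: eq_bigr => j _.
by case: eqVneq => _; case: eqVneq => _; case: eqVneq => _; case: eqVneq => _;
  rewrite /=; ring.
Qed.

Lemma cvg_laplacian (R : realType) (T : Type) (F : set_system T)
    (FF : Filter F) (n : nat) (f : T -> 'M[R]_n) (M : 'M[R]_n) :
  f x @[x --> F] --> M -> laplacian (f x) @[x --> F] --> laplacian M.
Proof.
move=> fM; apply: cvg_mx => i j; rewrite !mxE.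
under eq_cvg do rewrite !mxE.
apply: cvgB; first exact: cvg_mx_coord.
apply: cvgMn; apply: cvg_bigsum => k _; exact: cvg_mx_coord.
Qed.

Lemma continuous_slope_weights (R : realType) (n : nat) (A : 'M[R]_n)
    (p q : 'I_n) :
  continuous (fun z : 'rV[R]_n * 'rV[R]_n * R =>
    slope_weights (add_edge A p q z.2) z.1.1 z.1.2).
Proof.
move=> z; apply: cvg_mx => i j; rewrite !mxE.
under eq_cvg do rewrite !mxE.
have c11 k : (fun w : 'rV[R]_n * 'rV[R]_n * R => w.1.1 0 k) @ z --> z.1.1 0 k.
  apply: cvg_mx_coord; apply: (@cvg_comp _ _ _ fst fst _ (nbhs z.1)).
    exact: cvg_fst.
  exact: cvg_fst.
have c12 k : (fun w : 'rV[R]_n * 'rV[R]_n * R => w.1.2 0 k) @ z --> z.1.2 0 k.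
  apply: cvg_mx_coord; apply: (@cvg_comp _ _ _ fst snd _ (nbhs z.1)).
    exact: cvg_fst.
  exact: cvg_snd.
apply: cvgM; last by apply: cvg_sin_slope; exact: cvgB.
apply: cvgD; first exact: cvg_cst.
by apply: cvgMl; exact: cvg_snd.
Qed.

(** * Orthonormal eigenbases *)

Lemma dotvE (R : realType) (n : nat) (u v : 'rV[R]_n) :
  dotv u v = (u *m v^T) 0 0.
Proof. by rewrite mxE; apply: eq_bigr => j _; rewrite mxE. Qed.

(** The square matrix [V] of the vectors satisfies [V *m V^T = 1], hence [V^T *m V = 1], and
    [u = u *m V^T *m V]. *)
Lemma orthonormal_expand (R : realType) (n : nat) (v : 'I_n -> 'rV[R]_n) :
  (forall k l, dotv (v k) (v l) = (k == l)%:R) ->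
  forall u, u = \sum_k dotv u (v k) *: v k.
Proof.
move=> ov u; pose V := \matrix_k v k.
have VV : V *m V^T = 1%:M.
  apply/matrixP => k l; rewrite [RHS]mxE -ov !mxE.
  by apply: eq_bigr => j _; rewrite !mxE.
rewrite -[LHS]mulmx1 -(mulmx1C VV) mulmxA mulmx_sum_row.
apply: eq_bigr => k _; rewrite rowK mxE; congr (_ *: _).
by apply: eq_bigr => j _; rewrite !mxE.
Qed.

(** Expanding a kernel vector in the basis and pairing its image with [v l] leaves [mu l] times its
    [l]-th coefficient. *)
Lemma orthonormal_eigen_unitmx (R : realType) (n : nat)
    (v : 'I_n -> 'rV[R]_n) (M : 'M[R]_n) (mu : 'I_n -> R) :
  (forall k l, dotv (v k) (v l) = (k == l)%:R) ->
  (forall k, v k *m M = mu k *: v k) -> (forall k, mu k != 0) ->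
  M \in unitmx.
Proof.
move=> ov vM mu0; rewrite -row_free_unit -kermx_eq0; apply/rowV0P => u.
move=> /sub_kermxP; rewrite {1}(orthonormal_expand ov u) mulmx_suml => uM.
rewrite (orthonormal_expand ov u) big1// => l _.
have : dotv (\sum_k (dotv u (v k) *: v k) *m M) (v l) = 0.
  by rewrite uM dotvE mul0mx mxE.
rewrite dotvE mulmx_suml summxE (bigD1 l)//= big1 => [|k kl].
  rewrite addr0 -scalemxAl vM -!scalemxAl 2!mxE -dotvE ov eqxx mulr1 => /eqP.
  by rewrite mulf_eq0 (negbTE (mu0 l)) orbF => /eqP ->; rewrite scale0r.
by rewrite -scalemxAl vM -!scalemxAl 2!mxE -dotvE ov (negbTE kl) !mulr0.
Qed.

Lemma orthonormal_eigen_invmx (R : realType) (n : nat)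
    (v : 'I_n -> 'rV[R]_n) (M : 'M[R]_n) (mu : 'I_n -> R) (u w : 'rV[R]_n) :
  (forall k l, dotv (v k) (v l) = (k == l)%:R) ->
  (forall k, v k *m M = mu k *: v k) -> (forall k, mu k != 0) ->
  dotv (u *m invmx M) w = \sum_k dotv u (v k) * (dotv w (v k) / mu k).
Proof.
move=> ov vM mu0; have uM := orthonormal_eigen_unitmx ov vM mu0.
have vN k : v k *m invmx M = (mu k)^-1 *: v k.
  by rewrite -[v k in LHS](scalerK (mu0 k)) -vM -scalemxAl mulmxK.
rewrite {1}(orthonormal_expand ov u) mulmx_suml dotvE mulmx_suml summxE.
apply: eq_bigr => k _; rewrite -scalemxAl vN -!scalemxAl !mxE.
rewrite (_ : \sum_j _ = dotv w (v k)); first by rewrite (mulrC (dotv w _)).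
by apply: eq_bigr => j _; rewrite mxE mulrC.
Qed.

(** Applying [v k *m J] to the column of ones gives [lambda k] times the pairing of [v k] with it.
    So the constant vector is orthogonal to all [v k] except [v k0], and is a multiple of the
    latter. *)
Lemma kernel_eigenvector_const (R : realType) (n : nat)
    (v : 'I_n -> 'rV[R]_n) (J : 'M[R]_n) (lambda : 'I_n -> R) (k0 : 'I_n) :
  (forall k l, dotv (v k) (v l) = (k == l)%:R) ->
  (forall k, v k *m J = lambda k *: v k) ->
  (forall k, k != k0 -> lambda k != 0) ->
  J *m (const_mx 1 : 'cV[R]_n) = 0 ->
  exists2 c, c != 0 & v k0 = const_mx c.
Proof.
move=> ov vJ l0 J1; pose o : 'rV[R]_n := const_mx 1.
have oE : o = dotv o (v k0) *: v k0.
  rewrite [LHS](orthonormal_expand ov) (bigD1 k0)//= big1 ?addr0// => k kk0.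
  suff -> : dotv o (v k) = 0 by rewrite scale0r.
  have := congr1 (mulmx (v k)) J1; rewrite mulmxA vJ mulmx0 -scalemxAl.
  move=> /(congr1 (fun N : 'M[R]_1 => N 0 0)); rewrite !mxE => /eqP.
  rewrite mulf_eq0 (negbTE (l0 _ kk0)) /= => /eqP vk.
  by rewrite -[RHS]vk; apply: eq_bigr => j _; rewrite !mxE mulrC.
have d0 : dotv o (v k0) != 0.
  apply/eqP => d0; move: oE => /(congr1 (fun N : 'rV[R]_n => N 0 k0)).
  by rewrite d0 scale0r !mxE => /eqP; rewrite oner_eq0.
exists (dotv o (v k0))^-1; first by rewrite invr_eq0.
apply/rowP => j; rewrite mxE -[LHS](mulKf d0); move: oE.
move=> /(congr1 (fun N : 'rV[R]_n => N 0 j)); rewrite !mxE => <-.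
by rewrite mulr1.
Qed.

(** * The order parameter along a branch of phases *)

Lemma order_parameterE (R : realType) (n : nat) (theta : 'rV[R]_n) :
  order_parameter theta =
  Num.sqrt (((\sum_j cos (theta 0 j)) ^+ 2 + (\sum_j sin (theta 0 j)) ^+ 2)
            / n%:R ^+ 2).
Proof.
rewrite sqrtrM ?addr_ge0 ?sqr_ge0// sqrtrV ?sqr_ge0// sqrtr_sqr normr_nat.
rewrite /order_parameter; congr (_ / _).
have -> : \sum_j expi (theta 0 j) =
    ((\sum_j cos (theta 0 j)) +i* (\sum_j sin (theta 0 j)))%C.
  by elim/big_rec3 : _ => // j x y z _ ->.
by [].
Qed.

Lemma order_parameter_sqr (R : realType) (n : nat) (theta : 'rV[R]_n) :
  order_parameter theta ^+ 2 =
  ((\sum_j cos (theta 0 j)) ^+ 2 + (\sum_j sin (theta 0 j)) ^+ 2) / n%:R ^+ 2.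
Proof.
by rewrite order_parameterE sqr_sqrtr// divr_ge0 ?addr_ge0 ?sqr_ge0.
Qed.

(** [id] is there because the added weight [a] itself occurs in the entries of [L]. *)
Definition phase_functions (R : realType) (n : nat) (theta : R -> 'rV[R]_n) :
    set (R -> R) :=
  [set f | f = id \/ exists i, f = (fun a => cos (theta a 0 i)) \/
                               f = (fun a => sin (theta a 0 i))].

Lemma phase_functions_derive (R : realType) (n : nat) (theta : R -> 'rV[R]_n)
    (h : R -> 'rV[R]_n) (M : R -> 'M[R]_n) (U : set R) :
  (forall i, generated (phase_functions theta) (fun a => h a 0 i)) ->
  (forall i j, generated (phase_functions theta) (fun a => M a i j)) ->
  (forall a, U a -> M a \in unitmx) ->
  (forall a, U a -> is_derive a 1 theta (- (h a *m invmx (M a)))) ->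
  exists2 gen, phase_functions theta `<=` gen & forall f, gen f ->
    exists2 g, generated gen g & forall a, U a -> is_derive a 1 f (g a).
Proof.
move=> gh gM uM dtheta.
pose d a := (\det (M a))^-1.
pose gen := phase_functions theta `|` [set d].
have sub : phase_functions theta `<=` gen by exact: subsetUl.
have gd : generated gen d by apply: generated_gen; right.
pose T i a := - \sum_j h a 0 j * (d a * (\adj (M a)) j i).
have gT i : generated gen (T i).
  apply/generated_opp/generated_sum => j _.
  apply: generated_mul; first exact: (generatedS sub).
  apply: generated_mul => //; apply: (generatedS sub).
  exact: generated_adj.
have dT i a : U a -> is_derive a 1 (fun b => theta b 0 i) (T i a).
  move=> Ua; apply: (@is_derive_eq _ _ _ _ _ _ _ _
    (is_derive_mx_coord 0 i (dtheta a Ua))).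
  rewrite !mxE; congr (- _); apply: eq_bigr => j _.
  by rewrite /invmx uM// mxE.
have dphase f : phase_functions theta f ->
    exists2 g, generated gen g & forall a, U a -> is_derive a 1 f (g a).
  move=> [->|[i [->|->]]].
  - exists (cst 1); first exact: generated_cst.
    by move=> a _; exact: is_derive_id.
  - exists (fun a => (- sin (theta a 0 i)) * T i a).
      apply: generated_mul => //; apply/generated_opp/generated_gen.
      by left; right; exists i; right.
    by move=> a Ua; exact: is_derive1_comp (is_derive_cos _) (dT i a Ua).
  - exists (fun a => cos (theta a 0 i) * T i a).
      apply: generated_mul => //; apply/generated_gen.
      by left; right; exists i; left.
    by move=> a Ua; exact: is_derive1_comp (is_derive_sin _) (dT i a Ua).
exists gen => // f [/dphase//|->].
(* The determinant is a polynomial in the phase functions, whose derivatives are already known, so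
   differentiating [d] is not circular. *)
have [D gD dD] := generated_derive sub dphase (generated_det gM).
exists (fun a => - (d a * d a * D a)).
  by apply: generated_opp; apply: generated_mul => //; exact: generated_mul.
move=> a Ua; have d0 : \det (M a) != 0 by rewrite -unitfE -unitmxE uM.
have := is_deriveV d0 (dD a Ua).
by rewrite /d expr2 invfM -[_ *: _]/(_ * _) mulNr.
Qed.

(** Up to the factor [n^2] the function is [(C^2 + S^2) / 2], with derivative [C C' + S S'];
    collecting the coefficient of each [D 0 j] yields the gradient. *)
Lemma order_parameter_half_sqr_derive (R : realType) (n : nat)
    (theta : R -> 'rV[R]_n) (a : R) (D : 'rV[R]_n) :
  is_derive a 1 theta D ->
  is_derive a 1 (fun b => order_parameter (theta b) ^+ 2 / 2)
    (dotv D (order_gradient (theta a)) / n%:R ^+ 2).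
Proof.
move=> dtheta; have dT i := is_derive_mx_coord 0 i dtheta.
pose C b := \sum_j cos (theta b 0 j); pose S b := \sum_j sin (theta b 0 j).
have dC : is_derive a 1 C (\sum_j (- sin (theta a 0 j) * D 0 j)).
  rewrite (_ : C = \sum_j (cos \o (fun b => theta b 0 j))).
    apply: is_derive_sum => j; exact: is_derive1_comp (is_derive_cos _) (dT j).
  by apply/funext => b; rewrite fct_sumE.
have dS : is_derive a 1 S (\sum_j (cos (theta a 0 j) * D 0 j)).
  rewrite (_ : S = \sum_j (sin \o (fun b => theta b 0 j))).
    apply: is_derive_sum => j; exact: is_derive1_comp (is_derive_sin _) (dT j).
  by apply/funext => b; rewrite fct_sumE.
rewrite (_ : (fun b => _) = (2 * n%:R ^+ 2)^-1 \*: (C * C + S * S)); last first.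
  apply/funext => b; rewrite order_parameter_sqr -/(C b) -/(S b) !fctE.
  rewrite -[RHS]/(_ * (C b * C b + S b * S b)) [(2 * _)^-1]invfM.
  by set w := (n%:R ^+ 2)^-1; ring.
apply: is_derive_eq.
rewrite -![_ *: _]/(_ * _) /dotv.
under [in RHS]eq_bigr do rewrite mxE mulrBr.
rewrite sumrB.
set s1 := \sum_j (- sin (theta a 0 j) * D 0 j).
set s2 := \sum_j (cos (theta a 0 j) * D 0 j).
have -> : \sum_j (D 0 j * (S a * cos (theta a 0 j))) = S a * s2.
  by rewrite mulr_sumr; apply: eq_bigr => j _; ring.
have -> : \sum_j (D 0 j * (C a * sin (theta a 0 j))) = - (C a * s1).
  by rewrite mulr_sumr -sumrN; apply: eq_bigr => j _; ring.
rewrite invfM; set w := (n%:R ^+ 2)^-1; lra.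
Qed.

(** * The steady-state branch and the derivative formula *)

Theorem theorem2 (R : realType) (n : nat) (A : 'M[R]_n)
    (hA : connected_adjacency A)
    (Omega : 'rV[R]_n) (hOmega : \sum_i Omega 0 i = 0)
    (p q : 'I_n) (hpq : (p < q)%N) (K : R)
    (thetas : 'rV[R]_n)
    (hsteady : kuramoto A Omega p q thetas K 0 = 0)
    (lambda : 'I_n -> R) (v : 'I_n -> 'rV[R]_n)
    (heigen : forall k, v k *m
       'J (fun theta : 'rV[R]_n => kuramoto A Omega p q theta K 0) thetas
       = lambda k *: v k)
    (horthonormal : forall k l, dotv (v k) (v l) = (k == l)%:R)
    (hlambda1 : forall k : 'I_n, k = 0%N :> nat -> lambda k = 0)
    (hlambda2 : forall k : 'I_n, (0 < k)%N -> lambda k < 0)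
    (hsorted : forall k l : 'I_n, (k <= l)%N -> lambda l <= lambda k) :
  exists (theta : R -> 'rV[R]_n) (e : R),
    [/\ 0 < e,
        theta 0 = thetas /\ {for 0, continuous theta},
        (forall a, `|a| < e -> kuramoto A Omega p q (theta a) K a = 0) &
     [/\ smooth_on [set a | `|a| < e]
           (fun a => order_parameter (theta a) ^+ 2 / 2),
         (order_parameter thetas != 0 ->
            smooth_on [set a | `|a| < e]
              (fun a => order_parameter (theta a))) &
         is_derive (0 : R) (1 : R)
           (fun a => order_parameter (theta a) ^+ 2 / 2)
           (- (K / n%:R ^+ 2) * sin (thetas 0 q - thetas 0 p) *
            \sum_(k < n | (0 < k)%N)
              dotv (order_gradient thetas) (v k)
              * ((v k 0 p - v k 0 q) / lambda k))]].
Proof.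
have n0 : (0 < n)%N by exact: leq_ltn_trans (leq0n p) (ltn_ord p).
(* Indices start at 0: [v k0] is the first eigenvector, and the sum from the second one on ranges
   over [0 < k]. *)
pose k0 : 'I_n := Ordinal n0.
have pos_neq (k : 'I_n) : (0 < k)%N = (k != k0) by rewrite lt0n.
pose B := add_edge A p q.
have BT a : (B a)^T = B a.
  apply/matrixP => i j; rewrite !mxE (adj_sym hA j); congr (_ + _ * _).
  by rewrite addrC; congr (_%:R + _%:R); rewrite andbC.
pose J := K *: laplacian (slope_weights (B 0) thetas thetas).
pose L x y a := K *: laplacian (slope_weights (B a) x y) + (v k0)^T *m v k0.
pose G x a := kuramoto A Omega p q x K a + (x - thetas) *m (v k0)^T *m v k0.
pose h x : 'rV[R]_n := K *: edge_coupling p q x.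
have FL x y a : kuramoto A Omega p q x K a - kuramoto A Omega p q y K a =
    (x - y) *m (K *: laplacian (slope_weights (B a) x y)).
  rewrite !kuramoto_add_edge opprD addrACA subrr add0r -scalerBr.
  by rewrite sine_coupling_slope scalemxAr.
have GL x y a : G x a - G y a = (x - y) *m L x y a.
  rewrite mulmxDr -FL mulmxA opprD addrACA -mulmxBl -mulmxBl.
  by rewrite opprB addrA subrK.
have Lc0 : continuous (fun z : 'rV[R]_n * 'rV[R]_n * R =>
    K *: laplacian (slope_weights (B z.2) z.1.1 z.1.2)).
  move=> z; apply: cvgZr; apply: cvg_laplacian.
  exact: continuous_slope_weights.
have Lc : continuous (fun z : 'rV[R]_n * 'rV[R]_n * R => L z.1.1 z.1.2 z.2).
  by move=> z; apply: cvgD; [exact: Lc0|exact: cvg_cst].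
have Gh x a b : G x a - G x b = (a - b) *: h x.
  rewrite /G /kuramoto opprD addrACA subrr addr0 opprD addrACA subrr add0r.
  rewrite -scalerBr opprD addrACA subrr add0r -scalerBl /h !scalerA.
  by rewrite (mulrC K).
have JE :
    'J (fun theta : 'rV[R]_n => kuramoto A Omega p q theta K 0) thetas = J.
  (* The factorization is used with its second argument frozen at [thetas]. *)
  apply: (@jacobian_divided_difference _ _ _ _ _
    (fun x => K *: laplacian (slope_weights (B 0) x thetas))) => [x|].
    exact: FL.
  pose L3 (z : 'rV[R]_n * 'rV[R]_n * R) :=
    K *: laplacian (slope_weights (B z.2) z.1.1 z.1.2).
  apply: (@cvg_comp _ _ _ (fun x => (x, thetas, 0)) L3 _
    (nbhs (thetas, thetas, 0)) _ _ (Lc0 (thetas, thetas, 0))).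
  apply: (@cvg_pair _ _ _ (nbhs thetas) (nbhs (thetas, thetas)) (nbhs (0 : R))
    _ _ _); last exact: cvg_cst.
  apply: (@cvg_pair _ _ _ (nbhs thetas) (nbhs thetas) (nbhs thetas) _ _ _).
    exact: cvg_id.
  exact: cvg_cst.
have vJ k : v k *m J = lambda k *: v k by rewrite -JE.
have J1 : J *m (const_mx 1 : 'cV[R]_n) = 0.
  rewrite /J -scalemxAl laplacian_const ?scaler0//.
  apply/matrixP => i j; rewrite mxE [LHS]mxE [RHS]mxE !sin_slope_diag.
  have -> : B 0 j i = B 0 i j by rewrite -[in RHS](BT 0) [RHS]mxE.
  by rewrite -(opprB (thetas 0 i)) cosN.
have [c c0 vc] : exists2 c, c != 0 & v k0 = const_mx c.
  apply: (kernel_eigenvector_const horthonormal vJ) => // k kk0.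
  by rewrite lt_eqF// hlambda2// pos_neq.
(* By orthonormality the rank-one term of [L] maps [v k0] to itself and kills the other [v k], so
   only the eigenvalue 0 changes, to 1. *)
pose mu k := if k == k0 then 1 else lambda k.
have mu0 k : mu k != 0.
  rewrite /mu; case: (eqVneq k k0) => [_|kk0]; first exact: oner_neq0.
  by rewrite lt_eqF// hlambda2// pos_neq.
have vL k : v k *m L thetas thetas 0 = mu k *: v k.
  rewrite mulmxDr vJ mulmxA (mx11_scalar (v k *m _)) -dotvE horthonormal.
  rewrite mul_scalar_mx /mu; case: (eqVneq k k0) => [->|_].
    by rewrite hlambda1// scale0r add0r.
  by rewrite scale0r addr0.
have uL := orthonormal_eigen_unitmx horthonormal vL mu0.
have G0 : G thetas 0 = 0 by rewrite /G hsteady subrr !mul0mx addr0.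
have Gc x : continuous (G x).
  have -> : G x = (fun a => a *: h x + G x 0).
    by apply/funext => a; rewrite -[a in RHS]subr0 -Gh subrK.
  move=> a; apply: cvgD; last exact: cvg_cst.
  by apply: cvgZl; exact: cvg_id.
have G0F x a : G x a = 0 -> kuramoto A Omega p q x K a = 0.
  move=> Gx0; pose one : 'cV[R]_n := const_mx 1.
  have F1 : kuramoto A Omega p q x K a *m one = 0.
    rewrite kuramoto_add_edge; apply/matrixP => i j; rewrite !mxE !ord1.
    under eq_bigr do rewrite [one _ _]mxE mulr1 mxE.
    rewrite big_split /= hOmega add0r; under eq_bigr do rewrite mxE.
    by rewrite -mulr_sumr sum_sine_coupling// mulr0.
  have : G x a *m one = 0 by rewrite Gx0 mul0mx.
  (* Against the column of ones only the added term survives: [s], the component of [x - thetas]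
     along [v k0], times the nonzero [c *+ n]. Hence [s = 0]. *)
  rewrite mulmxDl F1 add0r -mulmxA (mx11_scalar ((x - thetas) *m _)).
  rewrite mul_scalar_mx.
  set s := ((x - thetas) *m _) 0 0.
  move=> /(congr1 (fun N : 'M[R]_1 => N 0 0)); rewrite mxE [RHS]mxE => /eqP.
  have -> : (v k0 *m one) 0 0 = c *+ n.
    rewrite mxE vc; under eq_bigr do rewrite !mxE mulr1.
    by rewrite sumr_const card_ord.
  rewrite mulf_eq0 mulrn_eq0 (negbTE c0) orbF -leqn0 leqNgt n0 orbF => /eqP s0.
  move: Gx0; rewrite /G (mx11_scalar ((x - thetas) *m _)) -/s s0.
  by rewrite mul_scalar_mx scale0r addr0.
have [theta [e [e0 theta0 thetaP]]] := implicit_function GL Lc Gc G0 uL.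
(* The square root is smooth only away from 0, so the interval is shrunk to keep [r] positive when
   [r] is nonzero at [thetas]; otherwise [e] is kept. *)
have [e' [e'0 e'e re']] : exists e', [/\ 0 < e', e' <= e &
    order_parameter thetas != 0 ->
    forall a, `|a| < e' -> 0 < order_parameter (theta a) ^+ 2].
  have [_|r0] := eqVneq (order_parameter thetas) 0; first by exists e.
  have rc : order_parameter (theta a) ^+ 2 @[a --> (0 : R)] -->
      order_parameter thetas ^+ 2.
    have [_ tc _] : [/\ G (theta 0) 0 = 0, {for 0, continuous theta} &
        L (theta 0) (theta 0) 0 \in unitmx] by apply: thetaP; rewrite normr0.
    have tc0 j : theta a 0 j @[a --> (0 : R)] --> thetas 0 j.
      by rewrite -theta0; apply: cvg_mx_coord; exact: tc.
    under eq_cvg do rewrite order_parameter_sqr.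
    rewrite order_parameter_sqr; apply: cvgMl; apply: cvgD.
      by apply: cvgM; apply: cvg_bigsum => j _;
        apply: continuous_cvg => //; exact: continuous_cos.
    by apply: cvgM; apply: cvg_bigsum => j _;
      apply: continuous_cvg => //; exact: continuous_sin.
  have r20 : 0 < order_parameter thetas ^+ 2 by rewrite exprn_even_gt0.
  have : \forall a \near (0 : R), 0 < order_parameter (theta a) ^+ 2.
    exact: (@cvgr_gt _ _ _ _ _ _ rc _ r20).
  move=> /nbhs_ballP[d /= d0 dr].
  exists (Num.min e d); split => [||_ a]; first by rewrite lt_min e0.
    by rewrite ge_min lexx.
  rewrite lt_min => /andP[_ ad]; apply: dr.
  by rewrite -ball_normE /= sub0r normrN.
pose U : set R := [set a | `|a| < e'].
have oU : open U.
  have -> : U = Num.norm @^-1` [set x : R | x < e'] by [].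
  apply: open_comp; last exact: open_lt.
  by move=> x _; exact: norm_continuous.
have Ue a : U a -> `|a| < e by move=> Ua; exact: lt_le_trans e'e.
have dtheta a : U a ->
    is_derive a 1 theta (- (h (theta a) *m invmx (L (theta a) (theta a) a))).
  move=> Ua; have [_ tc uLa] := thetaP a (Ue a Ua).
  apply: (implicit_function_derive GL Lc Gh) => //.
  have : \forall b \near a, U b by exact: open_nbhs_nbhs.
  by apply: filterS => b Ub; have [] := thetaP b (Ue b Ub).
have gcos i : generated (phase_functions theta) (fun a => cos (theta a 0 i)).
  by apply: generated_gen; right; exists i; left.
have gsin i : generated (phase_functions theta) (fun a => sin (theta a 0 i)).
  by apply: generated_gen; right; exists i; right.
have gcst x : generated (phase_functions theta) (fun=> x).
  exact: generated_cst.
have gid : generated (phase_functions theta) (fun a => a).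
  by apply: generated_gen; left.
have gsinB i j : generated (phase_functions theta)
    (fun a => sin (theta a 0 i - theta a 0 j)).
  under eq_fun do rewrite sinB.
  apply: generated_add; first exact: generated_mul.
  by apply: generated_opp; exact: generated_mul.
have gW i j : generated (phase_functions theta)
    (fun a => slope_weights (B a) (theta a) (theta a) i j).
  (* On the diagonal the slope is a cosine of a phase difference, which the addition formula makes
     polynomial in the generators. *)
  under eq_fun do rewrite mxE sin_slope_diag cosB !mxE.
  apply: generated_mul.
    by apply: generated_add => //; exact: generated_mul.
  by apply: generated_add; exact: generated_mul.
have [gen sub dgen] : exists2 gen, phase_functions theta `<=` gen &
    forall f, gen f -> exists2 g, generated gen g &
      forall a, U a -> is_derive a 1 f (g a).
  apply: (phase_functions_derive _ _ _ dtheta).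
  - move=> i; under eq_fun do rewrite !mxE.
    apply: generated_mul => //; apply: generated_mul => //.
  - move=> i j; under eq_fun do rewrite mxE.
    apply: generated_add => //; under eq_fun do rewrite mxE.
    apply: generated_mul => //; under eq_fun do rewrite mxE [_^T _ _]mxE.
    apply: generated_add => //; under eq_fun do rewrite !mxE -mulr_natr.
    apply: generated_opp; apply: generated_mul => //.
    exact: generated_sum.
  - by move=> a Ua; have [] := thetaP a (Ue a Ua).
have gr : generated (phase_functions theta)
    (fun a => order_parameter (theta a) ^+ 2).
  under eq_fun do rewrite order_parameter_sqr !expr2.
  apply: generated_mul => //.
  by apply: generated_add; apply: generated_mul; exact: generated_sum.
exists theta, e'; split => //.
- by split => //; have [] := thetaP 0; rewrite ?normr0.
- by move=> a ae; apply: G0F; have [] := thetaP a (Ue a ae).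
split.
- apply: (generated_smooth oU dgen); apply: (generatedS sub).
  exact: generated_mul.
- move=> r0; have -> : (fun a => order_parameter (theta a)) =
      (fun a => Num.sqrt (order_parameter (theta a) ^+ 2)).
    apply/funext => a; rewrite sqrtr_sqr ger0_norm//.
    by rewrite order_parameterE sqrtr_ge0.
  apply: (generated_smooth_sqrt oU dgen); first exact: (generatedS sub).
  exact: re'.
have U0 : U 0 by rewrite /U /= normr0.
apply: (is_derive_eq (order_parameter_half_sqr_derive (dtheta 0 U0))).
rewrite theta0 dotvE mulNmx mxE -dotvE.
rewrite (orthonormal_eigen_invmx _ _ horthonormal vL mu0).
rewrite (bigD1 k0)//=.
have hv k : dotv (h thetas) (v k) =
    K * (sin (thetas 0 q - thetas 0 p) * (v k 0 p - v k 0 q)).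
  by rewrite dotvE /h /edge_coupling -!scalemxAl mulmxBl -!rowE !mxE.
(* The [k0] term vanishes because the entries [p] and [q] of a constant vector agree. *)
rewrite hv vc !mxE subrr !mulr0 mul0r add0r.
under [in RHS]eq_bigl do rewrite pos_neq.
rewrite !mulNr; congr (- _); rewrite mulr_suml mulr_sumr.
apply: eq_bigr => k kk0; by rewrite hv /mu (negbTE kk0); ring.
Qed.
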